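(* Let $A$ be a (not necessarily commutative) domain, $S=A[\underline{t};\sigma,\underline{\delta}]$ a multivariate Ore extension in $n$ variables, and $\underline{a}\in A^n$. Put $C=C^{(\sigma,\underline{\delta})}(\underline{a})$. Then for any $1\le i\le n$ we have $T_{a_i}\in \mathrm{End}(A_C)$, i.e. $T_{a_i}$ is an endomorphism of $A$ viewed as a right $C$-module.
   Context: All rings are associative with identity, and ring homomorphisms preserve the identity. Let $n\ge 1$, $\sigma:A\to M_n(A)$ a ring homomorphism, and write $\sigma_{ij}(a)$ for the $(i,j)$ entry of $\sigma(a)$. Let $\underline{\delta}=(\delta_1,\dots,\delta_n)^t$ be a column of additive maps $A\to A$ forming a $\sigma$-derivation: $\delta_i(ab)=\sum_{j=1}^n\sigma_{ij}(a)\delta_j(b)+\delta_i(a)b$ for all $a,b\in A$, $1\le i\le n$. The multivariate Ore extension $S=A[\underline{t};\sigma,\underline{\delta}]$ is the ring of polynomials with left coefficients in $A$ in the free noncommuting variables $t_1,\dots,t_n$ with $t_ia=\sum_{j}\sigma_{ij}(a)t_j+\delta_i(a)$. For $\underline{a}=(a_1,\dots,a_n)^t\in A^n$, $T_{a_i}:A\to A$ is the additive map $T_{a_i}(b)=\sum_{j=1}^n\sigma_{ij}(b)a_j+\delta_i(b)$ (it depends on the whole of $\underline{a}$). The $(\sigma,\underline{\delta})$-centralizer of $\underline{a}$ is the subring $C^{(\sigma,\underline{\delta})}(\underline{a})=\{x\in A\mid \sigma(x)\underline{a}+\underline{\delta}(x)=\underline{a}x\}$ of $A$, where $\underline{\delta}(x)=(\delta_1(x),\dots,\delta_n(x))^t$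 and $\underline{a}x$ has entries $a_ix$. *)

(* Defs.v *)
From HB Require Import structures.
From mathcomp Require Import all_boot all_order all_algebra.

Set Implicit Arguments.
Unset Strict Implicit.
Unset Printing Implicit Defensive.

Import GRing.Theory.
Local Open Scope ring_scope.

(* [nzRingType] does not assume commutativity, whereas [idomainType] does. *)
Definition is_domain (A : nzRingType) : Prop :=
  forall x y : A, x * y = 0 -> x = 0 \/ y = 0.

Definition sigma_derivation (A : nzRingType) (n : nat)
    (sigma : {rmorphism A -> 'M[A]_n}) (delta : 'I_n -> {additive A -> A}) : Prop :=
  forall (a b : A) (i : 'I_n),
    delta i (a * b) = \sum_(j < n) sigma a i j * delta j b + delta i a * b.

(* The word [:: i1; ...; ik] encodes the monomial t_i1 * ... * t_ik. *)
Definition word_monomial (S : nzRingType) (n : nat) (t : 'I_n -> S)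
    (w : seq 'I_n) : S :=
  \prod_(i <- w) t i.

(* [S], with its coefficient embedding [iota] and its variables [t], is the
   ring A[t; sigma, delta]: the words in the variables form a basis of [S] as a
   left A-module (in particular [iota] is injective). *)
Record multivariate_ore_extension (A : nzRingType) (n : nat)
    (sigma : {rmorphism A -> 'M[A]_n}) (delta : 'I_n -> {additive A -> A})
    (S : nzRingType) (iota : {rmorphism A -> S}) (t : 'I_n -> S) : Prop :=
  MultivariateOreExtension {
    ore_commutation : forall (i : 'I_n) (a : A),
      t i * iota a = \sum_(j < n) iota (sigma a i j) * t j + iota (delta i a);
    ore_span : forall s : S,
      exists (W : seq (seq 'I_n)) (c : seq 'I_n -> A),
        s = \sum_(w <- W) iota (c w) * word_monomial t w;
    ore_free : forall (W : seq (seq 'I_n)) (c : seq 'I_n -> A),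
      uniq W -> \sum_(w <- W) iota (c w) * word_monomial t w = 0 ->
      forall w : seq 'I_n, w \in W -> c w = 0
  }.

Definition T_map (A : nzRingType) (n : nat)
    (sigma : {rmorphism A -> 'M[A]_n}) (delta : 'I_n -> {additive A -> A})
    (a : 'cV[A]_n) (i : 'I_n) (b : A) : A :=
  \sum_(j < n) sigma b i j * a j 0 + delta i b.

Definition centralizer (A : nzRingType) (n : nat)
    (sigma : {rmorphism A -> 'M[A]_n}) (delta : 'I_n -> {additive A -> A})
    (a : 'cV[A]_n) : {pred A} :=
  fun x => sigma x *m a + \col_i delta i x == \col_i (a i 0 * x).

(* MathComp only has left modules, so membership in End(A_C) is spelled out. *)
Definition right_module_endomorphism (A : nzRingType) (C : {pred A})
    (f : A -> A) : Prop :=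
  (forall x y : A, f (x + y) = f x + f y) /\
  (forall (x c : A), c \in C -> f (x * c) = f x * c).

Lemma centralizerP (A : nzRingType) (n : nat)
    (sigma : {rmorphism A -> 'M[A]_n}) (delta : 'I_n -> {additive A -> A})
    (a : 'cV[A]_n) (x : A) :
  reflect (forall i, T_map sigma delta a i x = a i 0 * x)
          (x \in centralizer sigma delta a).
Proof.
apply: (iffP eqP) => [/matrixP E i | E].
  by have := E i 0; rewrite !mxE.
by apply/matrixP => i j; rewrite (ord1 j) !mxE; exact: E.
Qed.

Lemma centralizer_subring (A : nzRingType) (n : nat)
    (sigma : {rmorphism A -> 'M[A]_n}) (delta : 'I_n -> {additive A -> A})
    (a : 'cV[A]_n) :
  sigma_derivation sigma delta ->
  subring_closed (centralizer sigma delta a).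
Proof.
move=> Hd; split.
- apply/centralizerP => i; rewrite /T_map rmorph1 mulr1.
  have -> : delta i 1 = 0.
    have := Hd 1 1 i; rewrite !mulr1 rmorph1.
    rewrite (bigD1 i) //= big1 => [|j ji]; last first.
      by rewrite mxE eq_sym (negbTE ji) mul0r.
    rewrite mxE eqxx mul1r addr0 => /esym/eqP.
    by rewrite -subr_eq0 addrK => /eqP.
  rewrite addr0 (bigD1 i) //= big1 => [|j ji]; last first.
    by rewrite mxE eq_sym (negbTE ji) mul0r.
  by rewrite mxE eqxx mul1r addr0.
- move=> x y /centralizerP Hx /centralizerP Hy; apply/centralizerP => i.
  rewrite mulrBr -Hx -Hy /T_map !raddfB /= opprD addrACA -sumrB.
  by congr (_ + _); apply: eq_bigr => j _; rewrite !mxE mulrBl.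
- move=> x y /centralizerP Hx /centralizerP Hy; apply/centralizerP => i.
  rewrite mulrA -Hx /T_map Hd mulrDl addrA; congr (_ + _).
  rewrite rmorphM /= mulr_suml.
  under eq_bigr => j _ do rewrite mxE mulr_suml.
  rewrite exchange_big /= -big_split /=; apply: eq_bigr => j _.
  under eq_bigr => k _ do rewrite -mulrA.
  rewrite -mulr_sumr -mulrDr -mulrA; congr (_ * _); exact: Hy.
Qed.

(* Main.v *)
Require Import Defs.
From HB Require Import structures.
From mathcomp Require Import all_boot all_order all_algebra.

Set Implicit Arguments.
Unset Strict Implicit.
Unset Printing Implicit Defensive.

Import GRing.Theory.
Local Open Scope ring_scope.

(** Each $T_{a_i}$ obeys a twisted product rule,
    $T_{a_i}(xy)=\sum_j\sigma_{ij}(x)T_{a_j}(y)+\delta_i(x)y$ ([T_mapM]). By [centralizerP], $c\in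
    C$ means $T_{a_j}(c)=a_jc$ for all $j$; putting $y=c$, the factor $c$ comes out on the right and
    leaves $T_{a_i}(x)c$. *)

Lemma T_mapM (A : nzRingType) (n : nat)
    (sigma : {rmorphism A -> 'M[A]_n}) (delta : 'I_n -> {additive A -> A})
    (a : 'cV[A]_n) (i : 'I_n) (x y : A) :
  sigma_derivation sigma delta ->
  T_map sigma delta a i (x * y) =
    \sum_(j < n) sigma x i j * T_map sigma delta a j y + delta i x * y.
Proof.
move=> sigma_der; rewrite /T_map sigma_der addrA; congr (_ + _).
rewrite rmorphM /=.
under eq_bigr => j _ do rewrite mxE mulr_suml.
(* Making the inner index of the matrix product $\sigma(x)\sigma(y)$ the outer one collects, for
   each [j], everything that $\sigma_{ij}(x)$ multiplies, including $\delta_j(y)$. *)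
rewrite exchange_big /= -big_split /=; apply: eq_bigr => j _.
rewrite mulrDr mulr_sumr; congr (_ + _).
by apply: eq_bigr => k _; rewrite mulrA.
Qed.

Theorem proposition5p4 (A : nzRingType) (n : nat)
    (sigma : {rmorphism A -> 'M[A]_n}) (delta : 'I_n -> {additive A -> A})
    (S : nzRingType) (iota : {rmorphism A -> S}) (t : 'I_n -> S)
    (a : 'cV[A]_n) (i : 'I_n) :
  is_domain A ->
  (1 <= n)%N ->
  sigma_derivation sigma delta ->
  multivariate_ore_extension sigma delta iota t ->
  right_module_endomorphism (centralizer sigma delta a) (T_map sigma delta a i).
Proof.
move=> _ _ sigma_der _; split=> [x y|x c /centralizerP Tc].
  rewrite /T_map !raddfD /= addrACA -big_split /=; congr (_ + _).
  by apply: eq_bigr => j _; rewrite mxE mulrDl.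
rewrite T_mapM // /T_map mulrDl mulr_suml; congr (_ + _).
(* The centralizer condition is needed at every index [j], not just at [i]. *)
by apply: eq_bigr => j _; rewrite -mulrA -Tc.
Qed.
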